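(* For $\ell\in\mathbb{Z}$ and $m=0,1,2,\ldots$, with $m\ge\ell$, the following reduction formula holds true for $x\in\mathbb{R}$: $$\left.\frac{\partial \mathrm{M}_{\kappa,\mu}(x)}{\partial\kappa}\right|_{\kappa=\ell/2,\,\mu=m+(1-\ell)/2}=(2m-\ell+1)\binom{2m-\ell}{m}x^{\ell/2-m}e^{-x/2}\Big\{(-1)^{m-\ell}\left(H_{m-\ell}-H_m\right)\left[e^{x}\mathcal{P}(-\ell,m-\ell,-x)-\mathcal{P}(\ell,m,x)\right]+x^{2m+1-\ell}\left[e^{x}\mathcal{F}(-\ell,m-\ell,-x)-\mathcal{F}(\ell,m,x)\right]\Big\}.$$
   Context: The Whittaker function is $\mathrm{M}_{\kappa,\mu}(x)=x^{\mu+1/2}e^{-x/2}\,{}_1F_1\!\left(\tfrac12+\mu-\kappa;\,1+2\mu;\,x\right)$, $2\mu\neq-1,-2,\ldots$, where ${}_1F_1$ is the Kummer confluent hypergeometric function. $H_n=\sum_{k=1}^n\frac1k$ is the $n$-th harmonic number ($H_0=0$). Further, $$\mathcal{P}(s,k,z)=\sum_{n=0}^{k}\binom{k}{n}(2k-s-n)!\,z^n,\qquad \mathcal{F}(s,k,z)=\sum_{n=0}^{k}(-1)^n\binom{k}{n}\frac{d^{\,n+k-s}}{dz^{\,n+k-s}}\left[\frac{\ln z-\mathrm{Chi}(z)-\mathrm{Shi}(z)+\gamma}{z}\right],$$ where $\gamma$ is Euler's constant, and $\mathrm{Shi}(z)=\int_0^z\frac{\sinh t}{t}dt$ and $\mathrm{Chi}(z)=\gamma+\ln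 z+\int_0^z\frac{\cosh t-1}{t}dt$ are the hyperbolic sine and cosine integrals (with the same branch of $\ln z$ throughout, so that the logarithms in the bracket cancel). *)

(* Defs.v *)
From Stdlib Require Import Reals ZArith.
From Coquelicot Require Import Coquelicot.

(* Stdlib and Coquelicot.  [C] is Coquelicot's type of complex numbers; the
   real binomial coefficient is [Binomial.C].  Everything is complex-valued:
   for x < 0 and half-integer exponents, M_{kappa,mu}(x) is not real. *)

Open Scope R_scope.

Definition Cexp (z : C) : C :=
  (exp (Re z) * cos (Im z), exp (Re z) * sin (Im z)).

Definition Ccosh (z : C) : C := ((Cexp z + Cexp (- z)) / 2)%C.

Definition Csinh (z : C) : C := ((Cexp z - Cexp (- z)) / 2)%C.

(* Principal argument, in (-PI, PI], for z <> 0. *)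
Definition Carg (z : C) : R :=
  if Rle_dec 0 (Im z) then acos (Re z / Cmod z) else - acos (Re z / Cmod z).

(* Principal branch, cut along the negative axis, on which Carg = PI. *)
Definition Cln (z : C) : C := (ln (Cmod z), Carg z).

(* Principal power; 0^0 = 1, and 0^s = 0 otherwise (the correct value when
   Re s > 0, the only case that occurs below). *)
Definition Cpower (z s : C) : C :=
  if Ceq_dec z 0 then (if Ceq_dec s 0 then RtoC 1 else RtoC 0)
  else Cexp (s * Cln z).

Definition CSeries (a : nat -> C) : C :=
  (Series (fun n => Re (a n)), Series (fun n => Im (a n))).

(* Rising factorial (a)_n. *)
Fixpoint poch (a : C) (n : nat) : C :=
  match n with
  | O => RtoC 1
  | S p => (poch a p * (a + INR p))%C
  end.

(* Meaningful for b not in {0, -1, -2, ...}. *)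
Definition hyp1F1 (a b z : C) : C :=
  CSeries (fun n => (poch a n / poch b n * (z ^ n / INR (fact n)))%C).

(* Meaningful for 2 mu not in {-1, -2, ...}. *)
Definition whittakerM (kappa mu x : C) : C :=
  (Cpower x (mu + / 2) * Cexp (- (x / 2))
     * hyp1F1 (/ 2 + mu - kappa) (1 + 2 * mu) x)%C.

(* The sum is empty, hence 0, for n = 0. *)
Definition harmonic (n : nat) : R := sum_n_m (fun k => / INR k) 1 n.

Definition euler_gamma : R := Lim_seq (fun n => harmonic n - ln (INR n)).

(* Integral of f along the segment from 0 to z. *)
Definition Cint0 (f : C -> C) (z : C) : C :=
  RInt (V := C_R_CompleteNormedModule) (fun u : R => (z * f (u * z))%C) 0 1.

(* The integrands of Shi and Chi are 0 instead of their limit at t = 0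
   (/ 0 = 0 in C); this one point does not affect the integrals. *)
Definition Shi (z : C) : C := Cint0 (fun t => (Csinh t / t)%C) z.

Definition Chi (z : C) : C :=
  (euler_gamma + Cln z + Cint0 (fun t => ((Ccosh t - 1) / t)%C) z)%C.

(* C_derive computes its limit along the horizontal direction only; it is the
   complex derivative wherever f is holomorphic (C_derive_correct), as the
   bracket in calF is off 0, the logarithms cancelling pointwise. *)
Definition C_derive_n (n : nat) (f : C -> C) : C -> C :=
  Nat.iter n C_derive f.

(* The truncation Z.to_nat is exact when s <= k, which holds at both places
   where calP and calF are used. *)
Definition calP (s : Z) (k : nat) (z : C) : C :=
  sum_n (fun n : nat =>
    (Binomial.C k n
       * INR (fact (Z.to_nat (2 * Z.of_nat k - s - Z.of_nat n)))
       * z ^ n)%C) k.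

(* The bracket has a removable singularity at 0 that is not removed here:
   calF is meaningful for z <> 0. *)
Definition calF (s : Z) (k : nat) (z : C) : C :=
  sum_n (fun n : nat =>
    ((-1) ^ n * Binomial.C k n
       * C_derive_n (Z.to_nat (Z.of_nat n + Z.of_nat k - s))
           (fun w : C => (Cln w - Chi w - Shi w + euler_gamma) / w) z)%C) k.

(* Main.v *)
Require Import Defs.
From Stdlib Require Import Reals ZArith Lra Lia.
From Coquelicot Require Import Coquelicot.
Open Scope R_scope.

(* With k = m - l and N = m + k, the function is, up to a factor independent
   of kappa, 1F1(a; N+2; x) near a = k+1, and the derivative in a can be taken
   termwise since each (a)_n has a second-order remainder bounded by
   |h|^2 n^2 (k+2)_n.  Everything else is an identity between real power series
   in x.  The bracket in calF is -sum z^n / (n! (n+1)^2), so calF(l,m,x) is, up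
   to sign, the exponential generating function of p |-> D^m g (p+k), where
   g(q) = 1/(q+1)^2 and D g(q) = g(q) - g(q+1); multiplying calF(-l,k,-x) by
   e^x turns D^k g (p+m) into D^p D^k g (m) = D^(p+k) g (m).  Since
   D^k g (y) = k! y!/(y+k+1)! (H_{y+k+1} - H_y), the highest harmonic numbers
   cancel in the difference.  The calP terms sum to a Kummer function because
   e^x calP(-l,k,-x) has coefficients (N-q)(N-q-1)...(N-q-k+1) m!/q!, which
   coincide with those of calP(l,m,x) for q <= m and vanish for m < q <= N. *)

(** * Binomial sums and finite differences *)

(** Pascal's rule followed by a shift of index. This is the induction step both for iterated
    differences and for the polynomials [calP]. *)
Lemma sum_binomial_S (k : nat) (f : nat -> R) :
  sum_f_R0 (fun n => Binomial.C (S k) n * f n) (S k)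
  = sum_f_R0 (fun n => Binomial.C k n * (f n + f (S n))) k.
Proof.
destruct k as [|k].
- simpl. unfold Binomial.C; simpl; field.
- rewrite (decomp_sum _ (S (S k))) by lia. simpl pred.
  rewrite tech5.
  rewrite (sum_eq (fun i => Binomial.C (S (S k)) (S i) * f (S i))
     (fun i => Binomial.C (S k) i * f (S i) + Binomial.C (S k) (S i) * f (S i))).
  2:{ intros i Hi. rewrite <- pascal by lia. ring. }
  rewrite plus_sum.
  rewrite (sum_eq (fun n => Binomial.C (S k) n * (f n + f (S n)))
     (fun n => Binomial.C (S k) n * f n + Binomial.C (S k) n * f (S n))).
  2:{ intros; ring. }
  rewrite plus_sum.
  rewrite (decomp_sum (fun n => Binomial.C (S k) n * f n) (S k)) by lia. simpl pred.
  rewrite (tech5 (fun n => Binomial.C (S k) n * f (S n))).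
  assert (E0 : forall n, Binomial.C n 0 = 1).
  { intro n. unfold Binomial.C. rewrite Nat.sub_0_r. simpl. field. apply INR_fact_neq_0. }
  assert (E1 : forall n, Binomial.C n n = 1).
  { intro n. unfold Binomial.C. rewrite Nat.sub_diag. simpl. field. apply INR_fact_neq_0. }
  rewrite !E0, !E1. ring.
Qed.

(** Iterates D g(y) = g(y) - g(y+1), the opposite of the usual forward difference; the sign agrees
    with the (-1)^n in [calF]. *)
Fixpoint fdiff (k : nat) (g : nat -> R) (y : nat) : R :=
  match k with
  | O => g y
  | S p => fdiff p g y - fdiff p g (S y)
  end.

Lemma fdiff_sum (k : nat) (g : nat -> R) (y : nat) :
  fdiff k g y = sum_f_R0 (fun n => Binomial.C k n * ((-1) ^ n * g (n + y)%nat)) k.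
Proof.
revert y; induction k as [|k IH]; intro y.
- simpl. unfold Binomial.C; simpl; field.
- rewrite sum_binomial_S. simpl fdiff. rewrite !IH, <- minus_sum.
  apply sum_eq; intros n Hn. rewrite Nat.add_succ_r. simpl. ring.
Qed.

Lemma fdiff_fdiff (p k : nat) (g : nat -> R) (y : nat) :
  fdiff p (fdiff k g) y = fdiff (p + k) g y.
Proof.
revert y; induction p as [|p IH]; intro y; simpl; [reflexivity|now rewrite !IH].
Qed.

Lemma harmonic_S (n : nat) : harmonic (S n) = harmonic n + / INR (S n).
Proof.
unfold harmonic.
destruct n as [|n].
- rewrite sum_n_n, sum_n_m_zero by lia. unfold zero; simpl. ring.
- rewrite sum_n_Sm by lia. reflexivity.
Qed.

Lemma INR_fact_S (n : nat) : INR (fact (S n)) = (INR n + 1) * INR (fact n).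
Proof. rewrite fact_simpl, mult_INR, S_INR. ring. Qed.

(** In the induction step the common factor is k! y!/(y+k+2)!. The harmonic differences contribute
    (k+1)(H_{y+k+1} - H_y), and the leftover terms 1 - (y+1)/(y+k+2) = (k+1)/(y+k+2) extend the sum
    to H_{y+k+2}. *)
Lemma fdiff_inv_sqr (k y : nat) :
  fdiff k (fun q => / (INR q + 1) ^ 2) y
  = INR (fact k) * INR (fact y) / INR (fact (y + k + 1))
    * (harmonic (y + k + 1) - harmonic y).
Proof.
revert y; induction k as [|k IH]; intro y.
- simpl fdiff. rewrite Nat.add_0_r, Nat.add_1_r, INR_fact_S, harmonic_S, S_INR.
  simpl fact. simpl INR.
  pose proof (pos_INR y). pose proof (INR_fact_neq_0 y). field. lra.
- simpl fdiff. rewrite !IH.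
  replace (S y + k + 1)%nat with (S (y + k + 1)) by lia.
  replace (y + S k + 1)%nat with (S (y + k + 1)) by lia.
  rewrite (INR_fact_S k), (INR_fact_S y), (INR_fact_S (y + k + 1)), !harmonic_S, !S_INR.
  rewrite !plus_INR. simpl INR.
  pose proof (pos_INR y). pose proof (pos_INR k).
  pose proof (INR_fact_neq_0 (y + k + 1)). field. lra.
Qed.

(** * Entire real power series *)

(** With a finite radius r, the terms at r + 1 would not tend to 0, against convergence there. *)
Lemma CV_radius_entire (a : nat -> R) :
  (forall x, ex_pseries a x) -> CV_radius a = p_infty.
Proof.
intro Ha. pose proof (CV_radius_ge_0 a) as H0.
pose proof (CV_disk_outside a (real (CV_radius a) + 1)) as Hout.
destruct (CV_radius a) as [r| |]; [|reflexivity|contradiction].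
simpl in H0, Hout. rewrite Rabs_pos_eq in Hout by lra.
exfalso. apply Hout; [lra|].
apply ex_series_lim_0. destruct (Ha (r + 1)) as [s Hs].
exists s. apply is_pseries_R. exact Hs.
Qed.

(** Comparison with M exp |x|. *)
Lemma CV_radius_fact_bound (a : nat -> R) (M : R) :
  (forall n, Rabs (a n) <= M / INR (fact n)) -> CV_radius a = p_infty.
Proof.
intro Ha. apply CV_radius_entire. intro x.
apply ex_pseries_R.
apply (ex_series_le (K := R_AbsRing) (V := R_CompleteNormedModule) _ (fun n => M * (/ INR (fact n) * Rabs x ^ n))).
- intro n. unfold norm; simpl. unfold abs; simpl.
  rewrite Rabs_mult, <- RPow_abs, <- Rmult_assoc.
  apply Rmult_le_compat_r; [apply pow_le, Rabs_pos|apply Ha].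
- exists (M * exp (Rabs x)). refine (is_series_scal (V := R_NormedModule) M _ (exp (Rabs x)) _).
  apply is_pseries_R, is_exp_Reals.
Qed.

(** Presents a polynomial as a power series, so that [calP] without its exponential can be
    subtracted coefficientwise. The partial sums are constant from index m on. *)
Lemma is_pseries_finite (u : nat -> R) (m : nat) (x : R) :
  is_pseries (fun q => if (q <=? m)%nat then u q else 0) x
    (sum_f_R0 (fun q => u q * x ^ q) m).
Proof.
apply is_pseries_R.
change (is_lim_seq (sum_n (fun q => (if (q <=? m)%nat then u q else 0) * x ^ q))
  (sum_f_R0 (fun q => u q * x ^ q) m)).
apply is_lim_seq_incr_n with (N := m).
apply is_lim_seq_ext with (fun _ => sum_f_R0 (fun q => u q * x ^ q) m);
  [|apply is_lim_seq_const].
intro n. rewrite sum_n_Reals. induction n as [|n IH].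
- apply sum_eq. intros i Hi. destruct (Nat.leb_spec i m); [reflexivity|lia].
- rewrite Nat.add_succ_l, tech5, <- IH.
  destruct (Nat.leb_spec (S (n + m)) m); [lia|ring].
Qed.

(** * Falling factorials, the polynomials [calP] and the Kummer series *)

(** The falling factorial y(y-1)...(y-k+1) takes a real argument because it is used at N - q, which
    is negative for q > N. *)
Fixpoint ffall (y : R) (k : nat) : R :=
  match k with
  | O => 1
  | S p => ffall y p * (y - INR p)
  end.

(** The real form of [calP] s k z, with N = 2k - s. *)
Definition binomial_fact_poly (k N : nat) (z : R) : R :=
  sum_f_R0 (fun n => Binomial.C k n * (INR (fact (N - n)) * z ^ n)) k.

Lemma binomial_fact_poly_S (k N : nat) (z : R) :
  binomial_fact_poly (S k) (S N) z
  = binomial_fact_poly k (S N) z + z * binomial_fact_poly k N z.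
Proof.
unfold binomial_fact_poly. rewrite sum_binomial_S, scal_sum, <- plus_sum.
apply sum_eq. intros n Hn. simpl (S N - S n)%nat. simpl pow. ring.
Qed.

(** Induction on k. After the shift by x, both series of the recursion carry the falling factorial
    of the same argument N + 1 - q; the remaining factors combine to (N + 1 - k) - q, which is the
    next factor of that falling factorial. *)
Lemma is_pseries_exp_binomial_fact_poly (k N : nat) (x : R) :
  (k <= N)%nat ->
  is_pseries (fun q => ffall (INR N - INR q) k * INR (fact (N - k)) / INR (fact q)) x
    (exp x * binomial_fact_poly k N (- x)).
Proof.
revert N; induction k as [|k IH]; intros N HkN.
- unfold binomial_fact_poly. simpl sum_f_R0. rewrite ?Nat.sub_0_r.
  replace (exp x * _) with (INR (fact N) * exp x).
  2:{ unfold Binomial.C. simpl. rewrite ?Nat.sub_0_r.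
      field. }
  apply is_pseries_ext with (PS_scal (INR (fact N)) (fun n => / INR (fact n))).
  + intro n. unfold PS_scal, scal; simpl; unfold mult; simpl. field. apply INR_fact_neq_0.
  + apply (is_pseries_scal (INR (fact N)) (fun n => / INR (fact n)) x (exp x)).
    * unfold mult; simpl; ring.
    * apply is_exp_Reals.
- destruct N as [|N]; [lia|].
  rewrite binomial_fact_poly_S.
  pose proof (is_pseries_minus _ _ _ _ _ (IH (S N) ltac:(lia))
     (is_pseries_incr_1 _ _ _ (IH N ltac:(lia)))) as H.
  replace (exp x * _) with
    (plus (exp x * binomial_fact_poly k (S N) (- x))
       (opp (scal x (exp x * binomial_fact_poly k N (- x))))).
  2:{ unfold plus, opp, scal; simpl; unfold mult; simpl. ring. }
  eapply is_pseries_ext; [|exact H].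
  assert (HS : forall y, ffall y (S k) = ffall y k * (y - INR k)) by reflexivity.
  assert (HN : INR (fact (S N - k)) = (INR N - INR k + 1) * INR (fact (N - k))).
  { replace (S N - k)%nat with (S (N - k)) by lia.
    rewrite INR_fact_S, minus_INR by lia. reflexivity. }
  intros [|q]; rewrite HS; simpl (S N - S k)%nat;
    unfold PS_minus, PS_plus, PS_opp, PS_incr_1; rewrite HN.
  + change (ffall (INR (S N) - INR 0) k * ((INR N - INR k + 1) * INR (fact (N - k)))
      / INR (fact 0) + - 0 = ffall (INR (S N) - INR 0) k * (INR (S N) - INR 0 - INR k)
      * INR (fact (N - k)) / INR (fact 0)).
    rewrite S_INR. simpl. field.
  + change (ffall (INR (S N) - INR (S q)) k * ((INR N - INR k + 1) * INR (fact (N - k)))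
      / INR (fact (S q)) + - (ffall (INR N - INR q) k * INR (fact (N - k)) / INR (fact q))
      = ffall (INR (S N) - INR (S q)) k * (INR (S N) - INR (S q) - INR k)
      * INR (fact (N - k)) / INR (fact (S q))).
    rewrite INR_fact_S, !S_INR.
    replace (INR N + 1 - (INR q + 1)) with (INR N - INR q) by ring.
    pose proof (pos_INR q). field. split; [apply INR_fact_neq_0|lra].
Qed.

(** This and the next two lemmas evaluate the falling factorial of k + m - q in the ranges q <= m, m
    < q <= k + m and q > k + m. *)
Lemma ffall_INR (k n : nat) : (k <= n)%nat ->
  ffall (INR n) k = INR (fact n) / INR (fact (n - k)).
Proof.
induction k as [|k IH]; intro H; simpl ffall.
- rewrite Nat.sub_0_r. field. apply INR_fact_neq_0.
- rewrite IH by lia. replace (n - k)%nat with (S (n - S k)) by lia.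
  rewrite INR_fact_S, minus_INR, S_INR by lia.
  assert (INR k + 1 <= INR n) by (rewrite <- S_INR; apply le_INR; lia).
  replace (INR n - (INR k + 1) + 1) with (INR n - INR k) by ring.
  field. split; [apply INR_fact_neq_0|lra].
Qed.

Lemma ffall_INR_0 (k n : nat) : (n < k)%nat -> ffall (INR n) k = 0.
Proof.
induction k as [|k IH]; intro H; [lia|]. simpl.
destruct (Nat.eq_dec n k) as [->|Hn]; [ring|rewrite IH by lia; ring].
Qed.

Lemma ffall_opp (k p : nat) :
  ffall (- (INR p + 1)) k = (-1) ^ k * INR (fact (p + k)) / INR (fact p).
Proof.
induction k as [|k IH]; simpl ffall.
- rewrite Nat.add_0_r. simpl. field. apply INR_fact_neq_0.
- rewrite IH, Nat.add_succ_r, INR_fact_S, plus_INR. simpl. field. apply INR_fact_neq_0.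
Qed.

(* Coefficients of [1F1(k+1; k+m+2; .)], up to the factor [(k+m+1)! / (k! m!)]. *)
Definition kummer_coef (k m p : nat) : R :=
  / INR (fact p) * (INR (fact (p + k)) * INR (fact m) / INR (fact (p + k + m + 1))).

Lemma is_pseries_kummer_coef (k m : nat) (x : R) :
  is_pseries (PS_incr_n (kummer_coef k m) (k + m + 1)) x
    ((-1) ^ k * (exp x * binomial_fact_poly k (k + m) (- x)
                 - binomial_fact_poly m (k + m) x)).
Proof.
pose proof (is_pseries_exp_binomial_fact_poly k (k + m) x ltac:(lia)) as H1.
pose proof (is_pseries_finite
  (fun q => Binomial.C m q * INR (fact (k + m - q))) m x) as H2.
pose proof (is_pseries_minus _ _ _ _ _ H1 H2) as H3.
apply (is_pseries_scal ((-1) ^ k)) in H3; [|apply Rmult_comm].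
match goal with |- is_pseries _ _ ?r => match type of H3 with is_pseries _ _ ?s =>
  replace r with s end end.
2:{ unfold plus, opp, scal; simpl; unfold mult; simpl. unfold binomial_fact_poly, Rminus.
    do 3 f_equal. apply sum_eq. intros; ring. }
eapply is_pseries_ext; [|exact H3].
intro q. unfold PS_scal, PS_minus, PS_plus, PS_opp, plus, opp, scal; simpl; unfold mult; simpl.
assert (Hs : (-1) ^ k * (-1) ^ k = 1).
{ rewrite <- Rpow_mult_distr. replace (-1 * -1) with 1 by ring. apply pow1. }
replace (k + m - k)%nat with m by lia.
destruct (Nat.le_gt_cases q (k + m)) as [Hq|Hq].
- assert (E : PS_incr_n (kummer_coef k m) (k + m + 1) q = 0).
  { revert q Hq. generalize (k + m)%nat. intro N. rewrite Nat.add_1_r.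
    intros q Hq. rewrite PS_incr_n_simplify.
    destruct le_lt_dec; [lia|reflexivity]. }
  rewrite E, <- minus_INR by lia.
  (* For q <= m both series have the coefficient (k+m-q)! m! / ((m-q)! q!). For m < q <= k + m the
     polynomial has ended and the falling factorial contains a factor 0. *)
  destruct (Nat.leb_spec q m) as [Hm|Hm].
  + rewrite ffall_INR by lia. unfold Binomial.C.
    replace (k + m - q - k)%nat with (m - q)%nat by lia.
    field. split; apply INR_fact_neq_0.
  + rewrite ffall_INR_0 by lia. field. apply INR_fact_neq_0.
- rewrite PS_incr_n_simplify. destruct le_lt_dec as [Hl|]; [|lia].
  destruct (Nat.leb_spec q m); [lia|].
  destruct (Nat.le_exists_sub _ _ Hl) as [p [-> _]].
  rewrite Nat.add_sub.
  replace (INR (k + m) - INR (p + (k + m + 1))) with (- (INR p + 1))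
    by (rewrite !plus_INR; simpl; ring).
  (* With q = p + k + m + 1 the argument is -(p+1); its falling factorial brings a second (-1)^k,
     which cancels the one in front. *)
  rewrite ffall_opp. unfold kummer_coef.
  replace (p + k + m + 1)%nat with (p + (k + m + 1))%nat by lia.
  transitivity ((-1) ^ k * (-1) ^ k * / INR (fact p) * (INR (fact (p + k)) * INR (fact m) / INR (fact (p + (k + m + 1))))).
  + field. split; apply INR_fact_neq_0.
  + rewrite Hs. ring.
Qed.

(** * Taylor series of the bracket and of the sums [calF] *)

Lemma is_pseries_sum (a : nat -> nat -> R) (s : nat -> R) (m : nat) (x : R) :
  (forall n, is_pseries (a n) x (s n)) ->
  is_pseries (fun p => sum_f_R0 (fun n => a n p) m) x (sum_f_R0 s m).
Proof.
intro H. induction m as [|m IH]; simpl.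
- apply H.
- apply (is_pseries_plus (fun p => sum_f_R0 (fun n => a n p) m) (a (S m))); auto.
Qed.

Lemma is_pseries_comp_opp (a : nat -> R) (x s : R) :
  is_pseries a (- x) s -> is_pseries (fun n => (-1) ^ n * a n) x s.
Proof.
intro H. apply is_pseries_R. apply is_pseries_R in H.
eapply is_series_ext; [|exact H].
intro n. simpl. replace (- x) with (-1 * x) by ring. rewrite Rpow_mult_distr. ring.
Qed.

Definition inv_sqr (q : nat) : R := / (INR q + 1) ^ 2.

(* Taylor coefficients of the bracket in calF. *)
Definition bracket_coef (n : nat) : R := - (/ INR (fact n) * inv_sqr n).

Lemma inv_sqr_bound (q : nat) : 0 <= inv_sqr q <= 1.
Proof.
unfold inv_sqr. pose proof (pos_INR q). split.
- apply Rlt_le, Rinv_0_lt_compat. apply pow_lt. lra.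
- rewrite <- Rinv_1. apply Rinv_le_contravar; [lra|]. nra.
Qed.

(** Each difference at most doubles the sup norm. The bound is uniform in y, as the radius of
    convergence of the series multiplied by exp requires. *)
Lemma fdiff_inv_sqr_bound (k y : nat) : Rabs (fdiff k inv_sqr y) <= 2 ^ k.
Proof.
revert y; induction k as [|k IH]; intro y; simpl fdiff.
- pose proof (inv_sqr_bound y). rewrite Rabs_pos_eq; simpl; lra.
- unfold Rminus. eapply Rle_trans; [apply Rabs_triang|]. rewrite Rabs_Ropp.
  pose proof (IH y). pose proof (IH (S y)). simpl. lra.
Qed.

Lemma CV_radius_bracket_coef : CV_radius bracket_coef = p_infty.
Proof.
apply CV_radius_fact_bound with 1. intro n. unfold bracket_coef.
rewrite Rabs_Ropp, Rabs_mult.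
rewrite Rabs_pos_eq by (apply Rlt_le, Rinv_0_lt_compat, INR_fact_lt_0).
pose proof (inv_sqr_bound n). rewrite Rabs_pos_eq by lra.
pose proof (Rinv_0_lt_compat _ (INR_fact_lt_0 n)). unfold Rdiv. nra.
Qed.

(** The real form of [calF] s m x with k = m - s, the derivatives being taken on the Taylor
    coefficients. *)
Definition bracket_diff (m k : nat) (x : R) : R :=
  sum_f_R0 (fun n => Binomial.C m n
    * ((-1) ^ n * PSeries (PS_derive_n (n + k) bracket_coef) x)) m.

(** The (n+k)-th derivative cancels the factorial in [bracket_coef]: its coefficient at p is
    -[inv_sqr] (n+k+p) / p!. The alternating binomial sum over n is then an m-th difference. *)
Lemma is_pseries_bracket_diff (m k : nat) (x : R) :
  is_pseries (fun p => - (/ INR (fact p) * fdiff m inv_sqr (p + k))) x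
    (bracket_diff m k x).
Proof.
eapply is_pseries_ext;
  [|apply (is_pseries_sum (fun n p => Binomial.C m n
       * ((-1) ^ n * PS_derive_n (n + k) bracket_coef p)))].
- intro p. simpl. rewrite fdiff_sum.
  replace (- (/ INR (fact p) * sum_f_R0 (fun n => Binomial.C m n * ((-1) ^ n * inv_sqr (n + (p + k)))) m))
    with (- / INR (fact p) * sum_f_R0 (fun n => Binomial.C m n * ((-1) ^ n * inv_sqr (n + (p + k)))) m) by ring.
  rewrite scal_sum. apply sum_eq. intros n Hn.
  unfold PS_derive_n, bracket_coef.
  replace (p + (n + k))%nat with (n + (p + k))%nat by lia.
  field. split; apply INR_fact_neq_0.
- intro n. apply is_pseries_R. rewrite <- Rmult_assoc.
  eapply is_series_ext; [|apply (is_series_scal (Binomial.C m n * (-1) ^ n)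
     (fun p => PS_derive_n (n + k) bracket_coef p * x ^ p))].
  + intro p. unfold scal; simpl; unfold mult; simpl. ring.
  + apply is_pseries_R, PSeries_correct, CV_radius_inside.
    rewrite CV_radius_derive_n, CV_radius_bracket_coef. exact I.
Qed.

Lemma is_pseries_exp_bracket_diff (m k : nat) (x : R) :
  is_pseries (fun p => - (/ INR (fact p) * fdiff (p + k) inv_sqr m)) x
    (exp x * bracket_diff k m (- x)).
Proof.
rewrite Rmult_comm.
eapply is_pseries_ext;
  [|apply (is_pseries_mult _ _ _ _ _
      (is_pseries_comp_opp _ _ _ (is_pseries_bracket_diff k m (- x)))
      (is_exp_Reals x))].
(* Evaluating at -x supplies (-1)^j, so p! times the Cauchy coefficient is an alternating binomial
   sum over j, up to the overall minus sign the p-th difference of y |-> D^k g(y) at m. *)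
- intro p. unfold PS_mult. rewrite <- fdiff_fdiff, fdiff_sum, <- Ropp_mult_distr_l_reverse.
  rewrite scal_sum. apply sum_eq. intros j Hj. unfold Binomial.C.
  field. repeat split; apply INR_fact_neq_0.
- rewrite (CV_radius_fact_bound _ (2 ^ k)); [exact I|].
  intro n. rewrite Rabs_mult, Rabs_Ropp, Rabs_mult, pow_1_abs, Rmult_1_l.
  rewrite Rabs_pos_eq by (apply Rlt_le, Rinv_0_lt_compat, INR_fact_lt_0).
  unfold Rdiv. rewrite Rmult_comm. apply Rmult_le_compat_r.
  + apply Rlt_le, Rinv_0_lt_compat, INR_fact_lt_0.
  + apply fdiff_inv_sqr_bound.
- rewrite (CV_radius_fact_bound _ 1); [exact I|].
  intro n. rewrite Rabs_pos_eq by (apply Rlt_le, Rinv_0_lt_compat, INR_fact_lt_0).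
  unfold Rdiv. lra.
Qed.

(** * The identity between real power series *)

(** The quotient (p+k)! m! / (p+k+m+1)! is at most 1, so the coefficients are bounded by 1/p!. *)
Lemma ex_pseries_kummer_coef (k m : nat) (x : R) : ex_pseries (kummer_coef k m) x.
Proof.
apply CV_radius_inside. rewrite (CV_radius_fact_bound _ 1); [exact I|].
intro p. unfold kummer_coef.
assert (H : (fact (p + k) * fact m <= fact (p + k + m + 1))%nat).
{ generalize (p + k)%nat. intro q. induction m as [|m IH].
  - rewrite Nat.add_0_r, Nat.add_1_r. simpl. nia.
  - replace (q + S m + 1)%nat with (S (q + m + 1)) by lia.
    rewrite !fact_simpl. nia. }
apply le_INR in H. rewrite mult_INR in H.
pose proof (INR_fact_lt_0 (p + k)). pose proof (INR_fact_lt_0 m).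
pose proof (INR_fact_lt_0 (p + k + m + 1)).
pose proof (Rinv_0_lt_compat _ (INR_fact_lt_0 p)).
assert (Hq : 0 <= INR (fact (p + k)) * INR (fact m) / INR (fact (p + k + m + 1)) <= 1).
{ split.
  - apply Rmult_le_pos; [nra|]. now apply Rlt_le, Rinv_0_lt_compat.
  - apply Rle_div_l; lra. }
rewrite Rabs_pos_eq; unfold Rdiv in *; nra.
Qed.

(* Up to the same factor, minus the derivative of these coefficients in the
   numerator parameter: [(a)_p' = (a)_p (H_{p+k} - H_k)] at [a = k + 1]. *)
Definition kummer_dcoef (k m p : nat) : R :=
  kummer_coef k m p * (harmonic k - harmonic (p + k)).

(** The expression in braces of the theorem, as x^(k+m+1) times one series. The two differences of g
    have the same prefactor and the same top term H_{p+k+m+1}; they leave H_m - H_{p+k}, and the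
    [calP] part adds H_k - H_m. *)
Lemma kummer_bracket_pseries (k m : nat) (x : R) :
  exists s, is_pseries (kummer_dcoef k m) x s /\
  (-1) ^ k * (harmonic k - harmonic m)
    * (exp x * binomial_fact_poly k (k + m) (- x) - binomial_fact_poly m (k + m) x)
  + x ^ (k + m + 1) * (exp x * bracket_diff k m (- x) - bracket_diff m k x)
  = x ^ (k + m + 1) * s.
Proof.
destruct (ex_pseries_kummer_coef k m x) as [s1 H1].
pose proof (is_pseries_incr_n _ (k + m + 1) _ _ H1) as H2.
pose proof (is_pseries_minus _ _ _ _ _ (is_pseries_exp_bracket_diff m k x)
   (is_pseries_bracket_diff m k x)) as H3.
apply is_pseries_unique in H2.
rewrite (is_pseries_unique _ _ _ (is_pseries_kummer_coef k m x)) in H2.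
change (scal (pow_n x (k + m + 1)) s1) with (x ^ (k + m + 1) * s1) in H2.
(* The braces with the factor x^(k+m+1) removed; nothing is divided by x, so x = 0 is included. *)
exists ((harmonic k - harmonic m) * s1
   + (exp x * bracket_diff k m (- x) - bracket_diff m k x)).
split.
- apply (is_pseries_scal (harmonic k - harmonic m)) in H1; [|apply Rmult_comm].
  pose proof (is_pseries_plus _ _ _ _ _ H1 H3) as H4.
  eapply is_pseries_ext; [|exact H4].
  intro p. unfold kummer_dcoef.
  change ((harmonic k - harmonic m) * kummer_coef k m p
    + (- (/ INR (fact p) * fdiff (p + k) inv_sqr m)
       + - - (/ INR (fact p) * fdiff m inv_sqr (p + k)))
    = kummer_coef k m p * (harmonic k - harmonic (p + k))).
  unfold inv_sqr. rewrite !fdiff_inv_sqr. unfold kummer_coef.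
  replace (m + (p + k) + 1)%nat with (p + k + m + 1)%nat by lia.
  field. split; apply INR_fact_neq_0.
- replace ((-1) ^ k * (harmonic k - harmonic m) *
   (exp x * binomial_fact_poly k (k + m) (- x) - binomial_fact_poly m (k + m) x))
  with ((harmonic k - harmonic m) * ((-1) ^ k *
   (exp x * binomial_fact_poly k (k + m) (- x) - binomial_fact_poly m (k + m) x))) by ring.
  rewrite H2. ring.
Qed.

(** * The bracket and its derivatives at real arguments *)

Lemma Cexp_RtoC (y : R) : Cexp (RtoC y) = RtoC (exp y).
Proof.
unfold Cexp, RtoC, Re, Im; simpl. now rewrite cos_0, sin_0, Rmult_1_r, Rmult_0_r.
Qed.

Lemma Cexp_plus (z w : C) : Cexp (z + w) = (Cexp z * Cexp w)%C.
Proof.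
destruct z as [a b], w as [c d]. unfold Cexp, Cmult, Re, Im; simpl.
rewrite exp_plus, cos_plus, sin_plus. f_equal; ring.
Qed.

Lemma sum_n_RtoC (f : nat -> C) (g : nat -> R) (k : nat) :
  (forall n, (n <= k)%nat -> f n = RtoC (g n)) -> sum_n f k = RtoC (sum_f_R0 g k).
Proof.
induction k as [|k IH]; intro H.
- rewrite sum_O. apply H. lia.
- rewrite sum_Sn, IH, H by auto. simpl sum_f_R0. rewrite RtoC_plus. reflexivity.
Qed.

(* [(exp y - 1) / y], with value [1] at [0]. *)
Definition expm1_quot : R -> R := PSeries (PS_decr_1 (fun n => / INR (fact n))).

Lemma expm1_quot_eq (y : R) : y * expm1_quot y = exp y - 1.
Proof.
unfold expm1_quot. pose proof (is_exp_Reals y) as H.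
pose proof (is_pseries_unique _ _ _ H) as E.
rewrite PSeries_decr_1 in E by (eexists; exact H). simpl in E. rewrite Rinv_1 in E. lra.
Qed.

(** Termwise integration of (e^y - 1)/y, then the substitution y = c w u. The values c = 1 and c =
    -1 serve the two exponentials in sinh and cosh. *)
Lemma is_RInt_expm1_quot (c w : R) : c <> 0 ->
  is_RInt (fun u => w * expm1_quot (c * (u * w))) 0 1
    (- (w * PSeries bracket_coef (c * w))).
Proof.
intro Hc.
(* Both sides are the sum of y^(n+1) / ((n+1)! (n+1)) at y = c w. *)
assert (HE : PSeries (PS_Int (PS_decr_1 (fun n => / INR (fact n)))) (c * w)
   = - (c * w * PSeries bracket_coef (c * w))).
{ rewrite Ropp_mult_distr_r, <- PSeries_opp, <- PSeries_incr_1.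
  apply PSeries_ext. intros [|n]; [reflexivity|].
  unfold PS_Int, PS_decr_1, PS_incr_1, PS_opp, bracket_coef, inv_sqr.
  change (/ INR (fact (S n)) / INR (S n) = - - (/ INR (fact n) * / (INR n + 1) ^ 2)).
  rewrite INR_fact_S, S_INR. pose proof (pos_INR n). field.
  split; [lra|apply INR_fact_neq_0]. }
assert (H : is_RInt expm1_quot (c * w * 0 + 0) (c * w * 1 + 0)
   (- (c * w * PSeries bracket_coef (c * w)))).
{ rewrite <- HE, Rmult_0_r, Rmult_1_r, !Rplus_0_r. apply is_RInt_PSeries.
  rewrite CV_radius_decr_1, (CV_radius_fact_bound _ 1); [exact I|].
  intro n. rewrite Rabs_pos_eq by (apply Rlt_le, Rinv_0_lt_compat, INR_fact_lt_0).
  unfold Rdiv. lra. }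
apply (is_RInt_comp_lin (V := R_NormedModule)) in H.
apply (is_RInt_scal (V := R_NormedModule) _ _ _ (/ c)) in H.
replace (- (w * PSeries bracket_coef (c * w)))
  with (/ c * - (c * w * PSeries bracket_coef (c * w))) by (field; exact Hc).
eapply is_RInt_ext; [|exact H].
intros u Hu. unfold scal; simpl; unfold mult; simpl.
rewrite Rplus_0_r. replace (c * w * u) with (c * (u * w)) by ring. field. exact Hc.
Qed.

(** Agreement is asked on the open interval only, so the values of the integrands of [Shi] and [Chi]
    at t = 0 do not matter. *)
Lemma is_RInt_RtoC (f : R -> C) (h : R -> R) (a b v : R) :
  (forall u, Rmin a b < u < Rmax a b -> f u = RtoC (h u)) -> is_RInt h a b v ->
  is_RInt (V := C_R_NormedModule) f a b (RtoC v).
Proof.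
intros Hf Hh.
apply (is_RInt_ext (fun u => RtoC (h u))).
{ intros u Hu. symmetry. now apply Hf. }
apply (is_RInt_fct_extend_pair (U := R_NormedModule) (V := R_NormedModule)); simpl.
- exact Hh.
- pose proof (is_RInt_const (V := R_NormedModule) a b 0) as H.
  unfold scal in H; simpl in H; unfold mult in H; simpl in H. rewrite Rmult_0_r in H. exact H.
Qed.

Lemma Ccosh_RtoC (y : R) : Ccosh (RtoC y) = RtoC ((exp y + exp (- y)) / 2).
Proof.
unfold Ccosh. rewrite <- RtoC_opp, !Cexp_RtoC, <- RtoC_plus, <- RtoC_div by lra. reflexivity.
Qed.

Lemma Csinh_RtoC (y : R) : Csinh (RtoC y) = RtoC ((exp y - exp (- y)) / 2).
Proof.
unfold Csinh. rewrite <- RtoC_opp, !Cexp_RtoC, <- RtoC_minus, <- RtoC_div by lra. reflexivity.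
Qed.

(** Since (cosh t - 1) + sinh t = e^t - 1, the logarithms and Euler's constant cancel and the
    bracket is minus the integral of (e^t - 1)/t, divided by w. *)
Lemma bracket_RtoC (w : R) : w <> 0 ->
  ((Cln w - Chi w - Shi w + euler_gamma) / w)%C = RtoC (PSeries bracket_coef w).
Proof.
intro Hw.
assert (Hp := is_RInt_expm1_quot 1 w ltac:(lra)).
assert (Hm := is_RInt_expm1_quot (-1) w ltac:(lra)).
assert (HS : Shi w = RtoC (/ 2 * (- (w * PSeries bracket_coef (1 * w))
     + - (w * PSeries bracket_coef (-1 * w))))).
{ unfold Shi, Cint0. apply (is_RInt_unique (V := C_R_CompleteNormedModule)).
  apply (is_RInt_RtoC _ (fun u => / 2 * (w * expm1_quot (1 * (u * w))
     + w * expm1_quot (-1 * (u * w))))).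
  - intros u Hu. rewrite Rmin_left, Rmax_right in Hu by lra.
    assert (Hy : u * w <> 0) by (apply Rmult_integral_contrapositive; split; lra).
    rewrite <- RtoC_mult, Csinh_RtoC, <- RtoC_div, <- RtoC_mult by exact Hy. f_equal.
    pose proof (expm1_quot_eq (1 * (u * w))) as E1. pose proof (expm1_quot_eq (-1 * (u * w))) as E2.
    replace (1 * (u * w)) with (u * w) in * by ring.
    replace (-1 * (u * w)) with (- (u * w)) in * by ring.
    replace (exp (u * w)) with (u * w * expm1_quot (u * w) + 1) by lra.
    replace (exp (- (u * w))) with (- (u * w) * expm1_quot (- (u * w)) + 1) by lra.
    field. split; lra.
  - apply (is_RInt_scal (V := R_NormedModule)).
    apply (is_RInt_plus (V := R_NormedModule)); assumption. }
assert (HC : Chi w = (euler_gamma + Cln w + RtoC (/ 2 * (- (w * PSeries bracket_coef (1 * w))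
     - - (w * PSeries bracket_coef (-1 * w)))))%C).
{ unfold Chi, Cint0. f_equal. apply (is_RInt_unique (V := C_R_CompleteNormedModule)).
  apply (is_RInt_RtoC _ (fun u => / 2 * (w * expm1_quot (1 * (u * w))
     - w * expm1_quot (-1 * (u * w))))).
  - intros u Hu. rewrite Rmin_left, Rmax_right in Hu by lra.
    assert (Hy : u * w <> 0) by (apply Rmult_integral_contrapositive; split; lra).
    rewrite <- RtoC_mult, Ccosh_RtoC, <- RtoC_minus, <- RtoC_div, <- RtoC_mult by exact Hy. f_equal.
    pose proof (expm1_quot_eq (1 * (u * w))) as E1. pose proof (expm1_quot_eq (-1 * (u * w))) as E2.
    replace (1 * (u * w)) with (u * w) in * by ring.
    replace (-1 * (u * w)) with (- (u * w)) in * by ring.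
    replace (exp (u * w)) with (u * w * expm1_quot (u * w) + 1) by lra.
    replace (exp (- (u * w))) with (- (u * w) * expm1_quot (- (u * w)) + 1) by lra.
    field. split; lra.
  - apply (is_RInt_scal (V := R_NormedModule)).
    apply (is_RInt_minus (V := R_NormedModule)); assumption. }
rewrite HS, HC. rewrite Rmult_1_l.
transitivity (RtoC (w * PSeries bracket_coef w / w)); [|f_equal; field; exact Hw].
rewrite RtoC_div by exact Hw. f_equal.
(* [A] comes from e^t and [B] from e^(-t); [B] cancels between [Chi] and [Shi]. *)
set (A := w * PSeries bracket_coef w). set (B := w * PSeries _ _).
unfold Cminus.
replace (RtoC (/ 2 * (- A - - B))) with (- RtoC A - RtoC (/ 2 * (- A + - B)))%C.
2:{ rewrite <- RtoC_opp, <- RtoC_minus. f_equal. field. }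
ring.
Qed.

(* [C_derive] only sees the horizontal direction, so it is the real derivative here. *)
Lemma C_derive_RtoC (f : C -> C) (g : R -> R) (z d : R) :
  locally z (fun x => f (RtoC x) = RtoC (g x)) -> is_derive g z d ->
  C_derive f (RtoC z) = RtoC d.
Proof.
intros Hf Hd. pose proof (locally_singleton _ _ Hf) as Hz.
assert (HL : locally' z (fun x => ((f (RtoC x) - f (RtoC z)) / (RtoC x - RtoC z))%C
    = RtoC ((g x - g z) / (x - z)))).
{ apply filter_imp with (2 := Hf). intros x Hx Hne.
  rewrite Hx, Hz, <- !RtoC_minus, <- RtoC_div; [reflexivity|]. lra. }
assert (H1 : is_lim (fun x => (g x - g z) / (x - z)) z d).
{ apply is_lim_spec. intro eps. apply is_derive_Reals in Hd.
  destruct (Hd eps (cond_pos eps)) as [del H]. exists del. intros y Hy Hne.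
  specialize (H (y - z)). replace (z + (y - z)) with y in H by (symmetry; apply Rplus_minus).
  apply H; [lra|exact Hy]. }
assert (H0 : is_lim (fun _ => 0) z 0) by apply is_lim_const.
transitivity ((real (Lim (fun x => (g x - g z) / (x - z)) z), real (Lim (fun _ => 0) z)) : C).
2:{ rewrite (is_lim_unique _ _ _ H1), (is_lim_unique _ _ _ H0). reflexivity. }
unfold C_derive, C_lim. change (fst (RtoC z)) with z. change (snd (RtoC z)) with 0.
f_equal; f_equal; apply Lim_ext_loc; apply filter_imp with (2 := HL); intros x Hx;
  change ((x, 0) : C) with (RtoC x); now rewrite Hx.
Qed.

Lemma C_derive_n_bracket_RtoC (n : nat) (z : R) : z <> 0 ->
  C_derive_n n (fun w : C => (Cln w - Chi w - Shi w + euler_gamma) / w)%C (RtoC z)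
  = RtoC (PSeries (PS_derive_n n bracket_coef) z).
Proof.
revert z; induction n as [|n IH]; intros z Hz.
- unfold C_derive_n; simpl. rewrite bracket_RtoC by exact Hz. f_equal.
  apply PSeries_ext. intro p. unfold PS_derive_n. rewrite Nat.add_0_r.
  field. apply INR_fact_neq_0.
- change (C_derive (C_derive_n n (fun w : C => (Cln w - Chi w - Shi w + euler_gamma) / w)%C) (RtoC z)
   = RtoC (PSeries (PS_derive_n (S n) bracket_coef) z)).
  apply (C_derive_RtoC _ (PSeries (PS_derive_n n bracket_coef))).
  (* The ball of radius |z| about z avoids 0, where the induction hypothesis says nothing. *)
  + exists (mkposreal _ (Rabs_pos_lt z Hz)). intros y Hy. apply IH.
    intros ->. unfold ball in Hy; simpl in Hy. unfold AbsRing_ball, abs, minus, plus, opp in Hy; simpl in Hy.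
    rewrite Rplus_0_l, Rabs_Ropp in Hy. lra.
  + rewrite (PSeries_ext _ (PS_derive (PS_derive_n n bracket_coef))).
    * apply is_derive_PSeries. rewrite CV_radius_derive_n, CV_radius_bracket_coef. exact I.
    * intro p. unfold PS_derive, PS_derive_n.
      replace (p + S n)%nat with (S p + n)%nat by lia.
      rewrite INR_fact_S, S_INR. pose proof (pos_INR p).
      field. split; [apply INR_fact_neq_0|lra].
Qed.

(** * Termwise differentiation in the numerator parameter *)

Lemma is_derive_of_quadratic_bound (f : C -> C) (z l : C) (M : R) :
  0 <= M ->
  (forall h : C, Cmod h <= 1 -> Cmod (f (z + h) - f z - h * l)%C <= M * Cmod h ^ 2) ->
  is_derive f z l.
Proof.
intros HM H. split; [apply (is_linear_scal_l (K := C_AbsRing) (V := C_NormedModule))|].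
intros y Hy. apply (is_filter_lim_locally_unique (K := C_AbsRing) (V := AbsRing_NormedModule C_AbsRing)) in Hy. subst y.
intro eps.
(* The 1 keeps the increment in the range of the hypothesis; M + 1 in place of M avoids a zero
   denominator. *)
assert (Hd : 0 < Rmin 1 (eps / (M + 1))).
{ apply Rmin_glb_lt; [lra|]. apply Rdiv_lt_0_compat; [apply cond_pos|lra]. }
exists (mkposreal _ Hd). intros y Hy.
change (Cmod (y - z) < Rmin 1 (eps / (M + 1))) in Hy.
change (Cmod (f y - f z - (y - z) * l)%C <= eps * Cmod (y - z)).
specialize (H (y - z)%C).
assert (E0 : forall u v : C, (u + (v - u))%C = v) by (intros; ring).
rewrite E0 in H.
pose proof (Rmin_l 1 (eps / (M + 1))). pose proof (Rmin_r 1 (eps / (M + 1))).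
eapply Rle_trans; [apply H; lra|].
pose proof (Cmod_ge_0 (y - z)).
simpl. rewrite Rmult_1_r, <- Rmult_assoc. apply Rmult_le_compat_r; [assumption|].
apply Rle_trans with ((M + 1) * Cmod (y - z)); [nra|].
assert (E : Cmod (y - z) <= eps / (M + 1)) by lra.
apply Rle_div_r in E; lra.
Qed.

Lemma Cmod_le_Rabs (z : C) : Cmod z <= Rabs (Re z) + Rabs (Im z).
Proof.
destruct z as [a b]. unfold Re, Im; simpl.
replace ((a, b) : C) with (RtoC a + (0, b))%C by (unfold RtoC, Cplus; simpl; f_equal; ring).
eapply Rle_trans; [apply Cmod_triangle|]. rewrite Cmod_R.
apply Rplus_le_compat_l. unfold Cmod; simpl.
replace (0 * (0 * 1) + b * (b * 1)) with (Rsqr b) by (unfold Rsqr; ring).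
rewrite sqrt_Rsqr_abs. apply Rle_refl.
Qed.

Lemma ex_series_Re_Im (u : nat -> C) (v : nat -> R) :
  (forall n, Cmod (u n) <= v n) -> ex_series v ->
  ex_series (fun n => Re (u n)) /\ ex_series (fun n => Im (u n)).
Proof.
intros Huv Hv. split.
- apply (ex_series_le (K := R_AbsRing) (V := R_CompleteNormedModule) _ v); [|exact Hv].
  intro n. eapply Rle_trans; [|apply Huv].
  eapply Rle_trans; [|apply Rmax_Cmod]. apply Rmax_l.
- apply (ex_series_le (K := R_AbsRing) (V := R_CompleteNormedModule) _ v); [|exact Hv].
  intro n. eapply Rle_trans; [|apply Huv].
  eapply Rle_trans; [|apply Rmax_Cmod]. apply Rmax_r.
Qed.

Lemma Rabs_Series_le (u v : nat -> R) :
  (forall n, Rabs (u n) <= v n) -> ex_series v -> Rabs (Series u) <= Series v.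
Proof.
intros Huv Hv. eapply Rle_trans; [apply Series_Rabs|apply Series_le].
- apply (ex_series_le (K := R_AbsRing) (V := R_CompleteNormedModule) _ v); [|exact Hv].
  intro n. unfold norm; simpl. unfold abs; simpl. rewrite Rabs_Rabsolu. apply Huv.
- intro n. split; [apply Rabs_pos|apply Huv].
- exact Hv.
Qed.

(** The factor 2 comes from bounding the real and imaginary parts separately, as [CSeries] is
    defined componentwise. *)
Lemma Cmod_CSeries_le (u : nat -> C) (v : nat -> R) :
  (forall n, Cmod (u n) <= v n) -> ex_series v -> Cmod (CSeries u) <= 2 * Series v.
Proof.
intros Huv Hv. eapply Rle_trans; [apply Cmod_le_Rabs|]. unfold CSeries, Re at 1, Im at 2; simpl.
assert (Rabs (Series (fun n => Re (u n))) <= Series v).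
{ apply Rabs_Series_le; [|exact Hv]. intro n. eapply Rle_trans; [|apply Huv].
  eapply Rle_trans; [|apply Rmax_Cmod]. apply Rmax_l. }
assert (Rabs (Series (fun n => Im (u n))) <= Series v).
{ apply Rabs_Series_le; [|exact Hv]. intro n. eapply Rle_trans; [|apply Huv].
  eapply Rle_trans; [|apply Rmax_Cmod]. apply Rmax_r. }
lra.
Qed.

Lemma CSeries_ext (u v : nat -> C) :
  (forall n, u n = v n) -> CSeries u = CSeries v.
Proof.
intro Huv. unfold CSeries. f_equal; apply Series_ext; intro n; now rewrite Huv.
Qed.

Lemma CSeries_minus (u1 u2 : nat -> C) (v1 v2 : nat -> R) :
  (forall n, Cmod (u1 n) <= v1 n) -> ex_series v1 ->
  (forall n, Cmod (u2 n) <= v2 n) -> ex_series v2 ->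
  CSeries (fun n => u1 n - u2 n)%C = (CSeries u1 - CSeries u2)%C.
Proof.
intros H1 E1 H2 E2.
destruct (ex_series_Re_Im _ _ H1 E1) as [R1 I1]. destruct (ex_series_Re_Im _ _ H2 E2) as [R2 I2].
unfold CSeries. unfold Cminus, Cplus, Copp; simpl. f_equal.
- apply (Series_minus _ _ R1 R2).
- apply (Series_minus _ _ I1 I2).
Qed.

Lemma CSeries_scal_RtoC (h : C) (u : nat -> R) :
  CSeries (fun n => h * RtoC (u n))%C = (h * RtoC (Series u))%C.
Proof.
destruct h as [a b]. unfold CSeries, Cmult, RtoC, Re, Im; simpl. f_equal.
- rewrite Rmult_0_r, Rminus_0_r, <- Series_scal_l. apply Series_ext. intro n. ring.
- rewrite Rmult_0_r, Rplus_0_l, <- Series_scal_l. apply Series_ext. intro n. ring.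
Qed.

Fixpoint Rpoch (a : R) (n : nat) : R :=
  match n with
  | O => 1
  | S p => Rpoch a p * (a + INR p)
  end.

Fixpoint Rpoch_deriv (a : R) (n : nat) : R :=
  match n with
  | O => 0
  | S p => Rpoch_deriv a p * (a + INR p) + Rpoch a p
  end.

Lemma poch_RtoC (a : R) (n : nat) : poch a n = RtoC (Rpoch a n).
Proof.
induction n as [|n IH]; simpl; [reflexivity|].
now rewrite IH, <- RtoC_plus, <- RtoC_mult.
Qed.

Lemma Rpoch_pos (a : R) (n : nat) : 0 < a -> 0 < Rpoch a n.
Proof.
intro Ha. induction n as [|n IH]; simpl; [lra|].
pose proof (pos_INR n). apply Rmult_lt_0_compat; lra.
Qed.

Lemma Cmod_poch_le (A : R) (h : C) (n : nat) :
  0 <= A -> Cmod h <= 1 -> Cmod (poch (A + h) n) <= Rpoch (A + 1) n.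
Proof.
intros HA Hh. induction n as [|n IH]; simpl poch; simpl Rpoch.
- rewrite Cmod_1. apply Rle_refl.
- rewrite Cmod_mult. apply Rmult_le_compat; [apply Cmod_ge_0|apply Cmod_ge_0|exact IH|].
  replace (A + h + INR n)%C with (RtoC (A + INR n) + h)%C by (rewrite RtoC_plus; ring).
  eapply Rle_trans; [apply Cmod_triangle|]. rewrite Cmod_R, Rabs_pos_eq; [lra|].
  pose proof (pos_INR n). lra.
Qed.

(** The difference d_n satisfies d_{n+1} = (A+n) d_n + h (A+h)_n, and |(A+h)_n| <= (A+1)_n. *)
Lemma Cmod_poch_diff_le (A : R) (h : C) (n : nat) :
  0 <= A -> Cmod h <= 1 ->
  Cmod (poch (A + h) n - RtoC (Rpoch A n))%C <= Cmod h * (INR n * Rpoch (A + 1) n).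
Proof.
intros HA Hh. pose proof (Cmod_ge_0 h) as H0.
induction n as [|n IH]; simpl poch; simpl Rpoch.
- replace (RtoC 1 - RtoC 1)%C with (RtoC 0) by ring. rewrite Cmod_0. simpl. lra.
- replace (poch (A + h) n * (A + h + INR n) - RtoC (Rpoch A n * (A + INR n)))%C
    with ((poch (A + h) n - RtoC (Rpoch A n)) * RtoC (A + INR n) + h * poch (A + h) n)%C
    by (rewrite RtoC_mult, RtoC_plus; ring).
  eapply Rle_trans; [apply Cmod_triangle|]. rewrite !Cmod_mult, Cmod_R, S_INR.
  pose proof (pos_INR n) as Hn. rewrite Rabs_pos_eq by lra.
  pose proof (Cmod_poch_le A h n HA Hh) as Hp.
  pose proof (Rpoch_pos (A + 1) n ltac:(lra)) as Hpos.
  apply Rle_trans with (Cmod h * (INR n * Rpoch (A + 1) n) * (A + INR n)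
     + Cmod h * Rpoch (A + 1) n).
  + apply Rplus_le_compat; [apply Rmult_le_compat_r; lra|apply Rmult_le_compat_l; lra].
  + replace (Cmod h * ((INR n + 1) * (Rpoch (A + 1) n * (A + 1 + INR n))))
     with (Cmod h * (INR n * Rpoch (A + 1) n) * (A + INR n) + Cmod h * Rpoch (A + 1) n
       + Cmod h * Rpoch (A + 1) n * (A + 2 * INR n)) by ring.
    assert (0 <= Cmod h * Rpoch (A + 1) n * (A + 2 * INR n)).
    { repeat apply Rmult_le_pos; lra. }
    lra.
Qed.

(** By the product rule the remainder satisfies r_{n+1} = (A+n) r_n + h ((A+h)_n - (A)_n), so the
    first-order bound supplies the second factor |h|. *)
Lemma Cmod_poch_remainder_le (A : R) (h : C) (n : nat) :
  0 <= A -> Cmod h <= 1 ->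
  Cmod (poch (A + h) n - RtoC (Rpoch A n) - h * RtoC (Rpoch_deriv A n))%C
  <= Cmod h ^ 2 * (INR n ^ 2 * Rpoch (A + 1) n).
Proof.
intros HA Hh. pose proof (Cmod_ge_0 h) as H0.
induction n as [|n IH]; simpl poch; simpl Rpoch; simpl Rpoch_deriv.
- replace (RtoC 1 - RtoC 1 - h * RtoC 0)%C with (RtoC 0) by ring. rewrite Cmod_0. simpl. lra.
- replace (poch (A + h) n * (A + h + INR n) - RtoC (Rpoch A n * (A + INR n))
     - h * RtoC (Rpoch_deriv A n * (A + INR n) + Rpoch A n))%C
    with ((poch (A + h) n - RtoC (Rpoch A n) - h * RtoC (Rpoch_deriv A n)) * RtoC (A + INR n)
      + h * (poch (A + h) n - RtoC (Rpoch A n)))%C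
    by (repeat rewrite ?RtoC_plus, ?RtoC_mult; ring).
  eapply Rle_trans; [apply Cmod_triangle|].
  rewrite (Cmod_mult _ (RtoC (A + INR n))), (Cmod_mult h), Cmod_R, S_INR.
  pose proof (pos_INR n) as Hn. rewrite Rabs_pos_eq by lra.
  pose proof (Cmod_poch_diff_le A h n HA Hh) as Hp.
  pose proof (Rpoch_pos (A + 1) n ltac:(lra)) as Hpos.
  apply Rle_trans with (Cmod h ^ 2 * (INR n ^ 2 * Rpoch (A + 1) n) * (A + INR n)
     + Cmod h * (Cmod h * (INR n * Rpoch (A + 1) n))).
  + apply Rplus_le_compat; [apply Rmult_le_compat_r; lra|apply Rmult_le_compat_l; lra].
  + replace (Cmod h ^ 2 * ((INR n + 1) ^ 2 * (Rpoch (A + 1) n * (A + 1 + INR n))))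
     with (Cmod h ^ 2 * (INR n ^ 2 * Rpoch (A + 1) n) * (A + INR n)
       + Cmod h * (Cmod h * (INR n * Rpoch (A + 1) n))
       + Cmod h ^ 2 * Rpoch (A + 1) n * (INR n ^ 2 - INR n + (2 * INR n + 1) * (A + 1 + INR n)))
     by ring.
    assert (0 <= Cmod h ^ 2 * Rpoch (A + 1) n *
       (INR n ^ 2 - INR n + (2 * INR n + 1) * (A + 1 + INR n))).
    { apply Rmult_le_pos; [apply Rmult_le_pos; [apply pow_le|]; lra|]. nra. }
    lra.
Qed.

Lemma CSeries_poch_quadratic_bound (A : R) (w : nat -> R) :
  0 <= A -> ex_series (fun n => (INR n + 1) ^ 2 * Rpoch (A + 1) n * Rabs (w n)) ->
  exists M : R, 0 <= M /\ forall h : C, Cmod h <= 1 ->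
  Cmod (CSeries (fun n => poch (A + h) n * RtoC (w n)) - CSeries (fun n => poch A n * RtoC (w n))
        - h * RtoC (Series (fun n => Rpoch_deriv A n * w n)%R))%C <= M * Cmod h ^ 2.
Proof.
(* The weight (n+1)^2 dominates both 1 and n^2, so [v] majorises the series and, up to |h|^2, the
   remainders. *)
intros HA Hex. set (v := fun n => (INR n + 1) ^ 2 * Rpoch (A + 1) n * Rabs (w n)) in Hex.
assert (Hv : forall n c, 0 <= c <= (INR n + 1) ^ 2 ->
   c * Rpoch (A + 1) n * Rabs (w n) <= v n).
{ intros n c Hc. unfold v. apply Rmult_le_compat_r; [apply Rabs_pos|].
  apply Rmult_le_compat_r; [|lra]. apply Rlt_le, Rpoch_pos. lra. }
assert (H1 : forall h : C, Cmod h <= 1 -> forall n, Cmod (poch (A + h) n * RtoC (w n))%C <= v n).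
{ intros h Hh n. rewrite Cmod_mult, Cmod_R. pose proof (pos_INR n).
  apply Rle_trans with (1 * Rpoch (A + 1) n * Rabs (w n)); [|apply Hv; nra].
  apply Rmult_le_compat_r; [apply Rabs_pos|]. rewrite Rmult_1_l. now apply Cmod_poch_le. }
assert (H2 : forall n, Cmod (poch A n * RtoC (w n))%C <= v n).
{ intro n. specialize (H1 (RtoC 0)). rewrite Cmod_0, Cplus_0_r in H1. apply H1. lra. }
assert (H3 : forall h : C, Cmod h <= 1 -> forall n,
   Cmod (poch (A + h) n * RtoC (w n) - poch A n * RtoC (w n)
        - h * RtoC (Rpoch_deriv A n * w n))%C <= Cmod h ^ 2 * v n).
{ intros h Hh n. rewrite poch_RtoC.
  replace (poch (A + h) n * RtoC (w n) - Rpoch A n * RtoC (w n)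
        - h * RtoC (Rpoch_deriv A n * w n))%C
   with ((poch (A + h) n - RtoC (Rpoch A n) - h * RtoC (Rpoch_deriv A n)) * RtoC (w n))%C
   by (rewrite RtoC_mult; ring).
  rewrite Cmod_mult, Cmod_R. pose proof (pos_INR n).
  apply Rle_trans with (Cmod h ^ 2 * (INR n ^ 2 * Rpoch (A + 1) n * Rabs (w n))).
  - rewrite <- Rmult_assoc. apply Rmult_le_compat_r; [apply Rabs_pos|].
    now apply Cmod_poch_remainder_le.
  - apply Rmult_le_compat_l; [apply pow2_ge_0|]. apply Hv. nra. }
assert (H4 : forall h : C, Cmod h <= 1 -> forall n,
   Cmod (poch (A + h) n * RtoC (w n) - poch A n * RtoC (w n))%C <= v n + v n).
{ intros h Hh n. unfold Cminus. eapply Rle_trans; [apply Cmod_triangle|].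
  rewrite Cmod_opp. apply Rplus_le_compat; auto. }
(* The linear term is the first difference minus the remainder, both already majorised; no separate
   bound on [Rpoch_deriv] is made. *)
assert (H5 : forall h : C, Cmod h <= 1 -> forall n,
   Cmod (h * RtoC (Rpoch_deriv A n * w n))%C <= (v n + v n) + v n).
{ intros h Hh n.
  replace (h * RtoC (Rpoch_deriv A n * w n))%C with
   ((poch (A + h) n * RtoC (w n) - poch A n * RtoC (w n)) -
    (poch (A + h) n * RtoC (w n) - poch A n * RtoC (w n)
        - h * RtoC (Rpoch_deriv A n * w n)))%C by ring.
  unfold Cminus at 1. eapply Rle_trans; [apply Cmod_triangle|].
  rewrite Cmod_opp. apply Rplus_le_compat; [now apply H4|].
  eapply Rle_trans; [now apply H3|].
  rewrite <- (Rmult_1_l (v n)) at 2. apply Rmult_le_compat_r.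
  - eapply Rle_trans; [apply Cmod_ge_0|apply (H2 n)].
  - pose proof (Cmod_ge_0 h). nra. }
assert (E2 : ex_series (fun n => v n + v n)) by now apply (ex_series_plus v v).
assert (E3 : ex_series (fun n => v n + v n + v n))
  by now apply (ex_series_plus (fun n => v n + v n) v).
exists (2 * Series v). split.
- eapply Rle_trans; [apply Cmod_ge_0|apply (Cmod_CSeries_le _ v H2 Hex)].
- intros h Hh. rewrite <- CSeries_scal_RtoC.
  rewrite <- (CSeries_minus _ _ v v) by auto.
  rewrite <- (CSeries_minus _ _ (fun n => v n + v n) (fun n => v n + v n + v n)) by auto.
  eapply Rle_trans; [apply (Cmod_CSeries_le _ (fun n => Cmod h ^ 2 * v n))|].
  + now apply H3.
  + now apply (ex_series_scal_l (Cmod h ^ 2) v).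
  + rewrite Series_scal_l. lra.
Qed.

(** * Principal powers of real numbers *)

Lemma Cmod_Cexp (z : C) : Cmod (Cexp z) = exp (Re z).
Proof.
unfold Cexp, Cmod; simpl.
replace (exp (Re z) * cos (Im z) * (exp (Re z) * cos (Im z) * 1)
   + exp (Re z) * sin (Im z) * (exp (Re z) * sin (Im z) * 1))
  with (exp (Re z) ^ 2 * (Rsqr (sin (Im z)) + Rsqr (cos (Im z)))) by (unfold Rsqr; ring).
rewrite sin2_cos2, Rmult_1_r, sqrt_pow2; [reflexivity|]. apply Rlt_le, exp_pos.
Qed.

Lemma Cexp_Cln_RtoC (x : R) : x <> 0 -> Cexp (Cln (RtoC x)) = RtoC x.
Proof.
intro Hx. unfold Cexp, Cln, Carg, Re, Im; simpl. rewrite Cmod_R.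
(* The imaginary part is 0, so [Carg] is the acos branch: 0 for x > 0 and PI for x < 0. *)
destruct (Rle_dec 0 0) as [_|H]; [|lra].
rewrite exp_ln by now apply Rabs_pos_lt.
destruct (Rle_lt_dec 0 x) as [H|H].
- rewrite Rabs_pos_eq by exact H. replace (x / x) with 1 by (field; exact Hx).
  rewrite acos_1, cos_0, sin_0. unfold RtoC. f_equal; ring.
- rewrite Rabs_left by exact H. replace (x / - x) with (- (1)) by (field; exact Hx).
  rewrite acos_opp, acos_1, Rminus_0_r, cos_PI, sin_PI. unfold RtoC. f_equal; ring.
Qed.

Lemma Cpower_RtoC_neq_0 (x : R) (s : C) : x <> 0 -> Cpower x s = Cexp (s * Cln x).
Proof.
intro Hx. unfold Cpower. destruct Ceq_dec as [E|_]; [|reflexivity].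
now apply RtoC_inj in E.
Qed.

(** Raising the exponent by an integer respects the branch because exp(ln x) = x. This moves
    x^(2m+1-l) into the prefactor. *)
Lemma Cpower_mult_pow (x : R) (s : C) (n : nat) : x <> 0 ->
  (Cpower x s * RtoC (x ^ n))%C = Cpower x (s + INR n).
Proof.
intro Hx. rewrite !Cpower_RtoC_neq_0 by exact Hx.
induction n as [|n IH].
- simpl. rewrite Cplus_0_r. apply Cmult_1_r.
- rewrite S_INR, RtoC_plus.
  replace ((s + (INR n + 1)) * Cln x)%C with ((s + INR n) * Cln x + Cln x)%C by ring.
  rewrite (Cexp_plus ((s + INR n) * Cln x)), <- IH, (Cexp_Cln_RtoC x Hx).
  simpl pow. rewrite RtoC_mult. ring.
Qed.

(** For a real exponent the modulus is |x|^p whatever the argument of x. Used for the limit at x =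
    0. *)
Lemma Cmod_Cpower_le (x p : R) : x <> 0 -> Rabs x <= 1 -> 1 <= p ->
  Cmod (Cpower x p) <= Rabs x.
Proof.
intros Hx Hx1 Hp. rewrite Cpower_RtoC_neq_0, Cmod_Cexp by exact Hx.
pose proof (Rabs_pos_lt x Hx) as Hpos.
unfold Cmult, Cln, Re, RtoC; simpl. rewrite Rmult_0_l, Rminus_0_r.
change (Cmod (x, 0)) with (Cmod (RtoC x)). rewrite Cmod_R.
rewrite <- (exp_ln (Rabs x)) at 2 by exact Hpos.
assert (Hl : ln (Rabs x) <= 0) by (rewrite <- ln_1; apply ln_le; assumption).
destruct (Rle_lt_or_eq_dec (p * ln (Rabs x)) (ln (Rabs x))) as [H|H]; [nra| |].
- now apply Rlt_le, exp_increasing.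
- rewrite H. apply Rle_refl.
Qed.

(** * The derivative of the Whittaker function in kappa *)

Lemma Rpoch_fact (j n : nat) :
  Rpoch (INR j + 1) n = INR (fact (n + j)) / INR (fact j).
Proof.
induction n as [|n IH]; simpl Rpoch.
- rewrite Nat.add_0_l. field. apply INR_fact_neq_0.
- rewrite IH, Nat.add_succ_l, INR_fact_S, plus_INR. field. apply INR_fact_neq_0.
Qed.

Lemma Rpoch_deriv_fact (j n : nat) :
  Rpoch_deriv (INR j + 1) n
  = INR (fact (n + j)) / INR (fact j) * (harmonic (n + j) - harmonic j).
Proof.
induction n as [|n IH]; simpl Rpoch_deriv.
- rewrite Nat.add_0_l. ring.
- rewrite IH, Rpoch_fact, Nat.add_succ_l, INR_fact_S, harmonic_S, S_INR, plus_INR.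
  pose proof (pos_INR n). pose proof (pos_INR j).
  field. split; [lra|apply INR_fact_neq_0].
Qed.

Lemma Rpoch_le (a b : R) (n : nat) : 0 < a <= b -> Rpoch a n <= Rpoch b n.
Proof.
intro H. induction n as [|n IH]; simpl; [lra|].
pose proof (pos_INR n).
apply Rmult_le_compat; [apply Rlt_le, Rpoch_pos; lra|lra|exact IH|lra].
Qed.

(** The quotient (a)_n/(b)_n is at most 1, and n + 1 <= 2^n by Bernoulli's inequality, so the
    exponential series at 4|x| is a majorant. *)
Lemma ex_series_kummer_majorant (a b x : R) : 0 < a <= b ->
  ex_series (fun n => (INR n + 1) ^ 2 * Rpoch a n
     * Rabs (/ Rpoch b n * (x ^ n / INR (fact n)))).
Proof.
intro Hab.
apply (ex_series_le (K := R_AbsRing) (V := R_CompleteNormedModule) _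
   (fun n => / INR (fact n) * (4 * Rabs x) ^ n)).
- intro n. change (Rabs ((INR n + 1) ^ 2 * Rpoch a n
      * Rabs (/ Rpoch b n * (x ^ n / INR (fact n)))) <= / INR (fact n) * (4 * Rabs x) ^ n).
  pose proof (Rpoch_pos a n ltac:(lra)) as Ha. pose proof (Rpoch_pos b n ltac:(lra)) as Hb.
  pose proof (Rpoch_le a b n Hab) as Hle. pose proof (INR_fact_lt_0 n) as Hf.
  pose proof (pos_INR n) as Hn.
  assert (H2 : INR n + 1 <= 2 ^ n).
  { pose proof (poly n 1 Rlt_0_1) as H. replace (1 + 1) with 2 in H by ring. lra. }
  assert (Hd : 0 <= Rpoch a n / Rpoch b n <= 1).
  { split; [apply Rlt_le, Rdiv_lt_0_compat; assumption|]. apply Rle_div_l; lra. }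
  assert (Hx : 0 <= Rabs x ^ n / INR (fact n)).
  { apply Rdiv_le_0_compat; [apply pow_le, Rabs_pos|exact Hf]. }
  rewrite Rabs_mult, Rabs_Rabsolu, (Rabs_mult (/ Rpoch b n)), Rabs_div, <- RPow_abs, Rabs_inv by lra.
  rewrite (Rabs_pos_eq (INR (fact n))), (Rabs_pos_eq (Rpoch b n)) by lra.
  rewrite Rabs_pos_eq by (apply Rmult_le_pos; [apply pow2_ge_0|lra]).
  replace ((INR n + 1) ^ 2 * Rpoch a n * (/ Rpoch b n * (Rabs x ^ n / INR (fact n))))
    with (((INR n + 1) ^ 2 * (Rpoch a n / Rpoch b n)) * (Rabs x ^ n / INR (fact n)))
    by (unfold Rdiv; ring).
  replace (/ INR (fact n) * (4 * Rabs x) ^ n) with (4 ^ n * (Rabs x ^ n / INR (fact n)))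
    by (rewrite Rpow_mult_distr; unfold Rdiv; ring).
  apply Rmult_le_compat_r; [exact Hx|].
  replace 4 with (2 * 2) by ring. rewrite Rpow_mult_distr.
  apply Rle_trans with ((INR n + 1) ^ 2 * 1); nra.
- exists (exp (4 * Rabs x)). apply is_pseries_R, is_exp_Reals.
Qed.

(** The parameter kappa occurs only in a = 1/2 + mu - kappa. The constant (k+m+1) C(k+m,m) =
    (k+m+1)!/(k! m!) restores the factor removed from [kummer_coef]. *)
Lemma is_derive_whittakerM (k m : nat) (x : R) (kappa mu : R) (s : R) :
  / 2 + mu - kappa = INR k + 1 -> 1 + 2 * mu = INR (k + m) + 2 ->
  is_pseries (kummer_dcoef k m) x s ->
  is_derive (fun kappa' : C => whittakerM kappa' mu x) (RtoC kappa)
    (Cpower x (mu + / 2) * Cexp (- (x / 2))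
       * RtoC (INR (k + m + 1) * Binomial.C (k + m) m * s))%C.
Proof.
intros Ha Hb Hs.
(* Equal to k + m + 2, written as an integer plus 1 to fit [Rpoch_fact]. *)
set (b := INR (k + m + 1) + 1).
assert (Hbb : INR (k + m) + 2 = b) by (unfold b; rewrite (plus_INR (k + m) 1); simpl; ring).
set (w := fun n => / Rpoch b n * (x ^ n / INR (fact n))).
pose proof (pos_INR k) as Hk. pose proof (pos_INR (k + m)) as Hkm.
assert (Hw : forall kappa' n, (poch (/ 2 + mu - kappa') n / poch (1 + 2 * mu) n
     * (x ^ n / INR (fact n)))%C = (poch (/ 2 + mu - kappa') n * RtoC (w n))%C).
{ intros kappa' n. rewrite <- RtoC_mult, <- RtoC_plus, Hb, Hbb, poch_RtoC.
  unfold w. pose proof (Rpoch_pos b n ltac:(lra)).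
  rewrite RtoC_mult, RtoC_inv, RtoC_div, RtoC_pow by (try apply INR_fact_neq_0; lra).
  unfold Cdiv. ring. }
destruct (CSeries_poch_quadratic_bound (INR k + 1) w) as [M [HM H]]; [lra| |].
(* The majorant is taken at a + 1 = k + 2, which does not exceed b = k + m + 2. *)
{ apply ex_series_kummer_majorant. rewrite <- Hbb, plus_INR. pose proof (pos_INR m). lra. }
assert (Hsum : Series (fun n => Rpoch_deriv (INR k + 1) n * w n)
   = - (INR (k + m + 1) * Binomial.C (k + m) m * s)).
{ apply is_series_unique. apply is_pseries_R in Hs.
  apply (is_series_scal (V := R_NormedModule) (- (INR (k + m + 1) * Binomial.C (k + m) m))) in Hs.
  replace (- (INR (k + m + 1) * Binomial.C (k + m) m * s))
    with (- (INR (k + m + 1) * Binomial.C (k + m) m) * s) by ring.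
  eapply is_series_ext; [|exact Hs].
  intro n.
  change (- (INR (k + m + 1) * Binomial.C (k + m) m) * (kummer_dcoef k m n * x ^ n)
    = Rpoch_deriv (INR k + 1) n * w n).
  unfold w, b, kummer_dcoef, kummer_coef, Binomial.C. rewrite Rpoch_deriv_fact, Rpoch_fact.
  replace (k + m - m)%nat with k by lia.
  replace (n + (k + m + 1))%nat with (n + k + m + 1)%nat by lia.
  replace (INR (fact (k + m + 1))) with (INR (k + m + 1) * INR (fact (k + m)))
    by (rewrite Nat.add_1_r, INR_fact_S, S_INR; ring).
  rewrite (plus_INR (k + m) 1). simpl (INR 1).
  field. repeat split; try apply INR_fact_neq_0. lra. }
set (c := (Cpower x (mu + / 2) * Cexp (- (x / 2)))%C).
apply is_derive_of_quadratic_bound with (Cmod c * M).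
{ apply Rmult_le_pos; [apply Cmod_ge_0|exact HM]. }
(* An increment h of kappa is -h in a; the sign cancels the minus sign in [Hsum]. *)
intros h Hh. specialize (H (- h)%C). rewrite Cmod_opp, Hsum, RtoC_opp in H. specialize (H Hh).
unfold whittakerM, hyp1F1. fold c.
rewrite (CSeries_ext _ _ (Hw (kappa + h)%C)), (CSeries_ext _ _ (Hw kappa)).
assert (E0 : (/ 2 + mu - kappa)%C = RtoC (INR k + 1)).
{ rewrite <- Ha, RtoC_minus, RtoC_plus, RtoC_inv by lra. reflexivity. }
replace (/ 2 + mu - (kappa + h))%C with (RtoC (INR k + 1) + - h)%C by (rewrite <- E0; ring).
rewrite E0.
match type of H with (Cmod (?S1 - ?S2 - _)%C <= _) => set (s1 := S1) in *; set (s2 := S2) in * end.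
replace (c * s1 - c * s2 - h * (c * RtoC (INR (k + m + 1) * Binomial.C (k + m) m * s)))%C
 with (c * (s1 - s2 - - h * - RtoC (INR (k + m + 1) * Binomial.C (k + m) m * s)))%C by ring.
rewrite Cmod_mult, (Rmult_assoc (Cmod c)). apply Rmult_le_compat_l; [apply Cmod_ge_0|exact H].
Qed.

(** * The reduction formula *)

Lemma calP_RtoC (s : Z) (k N : nat) (z : R) :
  (2 * Z.of_nat k - s = Z.of_nat N)%Z ->
  calP s k z = RtoC (binomial_fact_poly k N z).
Proof.
intro HN. apply sum_n_RtoC. intros n Hn.
replace (Z.to_nat (2 * Z.of_nat k - s - Z.of_nat n)) with (N - n)%nat by lia.
rewrite <- RtoC_pow, <- !RtoC_mult. now rewrite Rmult_assoc.
Qed.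

Lemma calF_RtoC (s : Z) (m k : nat) (z : R) : z <> 0 ->
  (Z.of_nat m - s = Z.of_nat k)%Z -> calF s m z = RtoC (bracket_diff m k z).
Proof.
intros Hz Hk. apply sum_n_RtoC. intros n Hn.
replace (Z.to_nat (Z.of_nat n + Z.of_nat m - s)) with (n + k)%nat by lia.
rewrite C_derive_n_bracket_RtoC, <- RtoC_pow, <- !RtoC_mult by exact Hz. f_equal. ring.
Qed.

Lemma filterlim_locally_C_0 (f : R -> C) (M : R) :
  locally' 0 (fun x => Cmod (f x) <= Rabs x * M) ->
  filterlim f (locally' 0) (locally (RtoC 0)).
Proof.
intro Hf. apply filterlim_locally. intro eps.
assert (Hd : 0 < eps / (Rabs M + 1)).
{ apply Rdiv_lt_0_compat; [apply cond_pos|]. pose proof (Rabs_pos M). lra. }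
assert (Hl : locally' 0 (fun x => Rabs x < eps / (Rabs M + 1))).
{ exists (mkposreal _ Hd). intros y Hy _.
  change (Rabs (y - 0) < eps / (Rabs M + 1)) in Hy. now rewrite Rminus_0_r in Hy. }
apply filter_imp with (2 := filter_and _ _ Hf Hl). intros x [H1 H2].
assert (H : Cmod (f x) < eps).
{ pose proof (Rle_abs M). pose proof (Rabs_pos M). pose proof (Rabs_pos x).
  apply Rlt_div_r in H2; [|lra]. nra. }
pose proof (Rmax_Cmod (f x)) as Hm.
split.
- change (Rabs (fst (f x) - 0) < eps). rewrite Rminus_0_r.
  eapply Rle_lt_trans; [|exact H]. eapply Rle_trans; [apply Rmax_l|exact Hm].
- change (Rabs (snd (f x) - 0) < eps). rewrite Rminus_0_r.
  eapply Rle_lt_trans; [|exact H]. eapply Rle_trans; [apply Rmax_r|exact Hm].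
Qed.

Theorem theorem17 (l : Z) (m : nat) (hlm : (l <= Z.of_nat m)%Z) :
  let k := Z.to_nat (Z.of_nat m - l) in
  let kappa0 : C := RtoC (IZR l / 2) in
  let mu0 : C := RtoC (INR m + (1 - IZR l) / 2) in
  let rhs : R -> C := fun x : R =>
    (IZR (2 * Z.of_nat m - l + 1)
     * Binomial.C (Z.to_nat (2 * Z.of_nat m - l)) m
     * Cpower x (RtoC (IZR l / 2 - INR m)%R) * Cexp (- (x / 2))
     * ((-1) ^ k * (harmonic k - harmonic m)
          * (Cexp x * calP (- l) k (- x) - calP l m x)
        + x ^ Z.to_nat (2 * Z.of_nat m + 1 - l)
          * (Cexp x * calF (- l) k (- x) - calF l m x)))%C in
  (forall x : R, x <> 0 ->
     is_derive (fun kappa : C => whittakerM kappa mu0 x) kappa0 (rhs x)) /\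
  (* the right-hand side has a removable singularity at x = 0 *)
  (exists v : C,
     filterlim rhs (locally' 0) (locally v) /\
     is_derive (fun kappa : C => whittakerM kappa mu0 0) kappa0 v).
Proof.
intros k kappa0 mu0 rhs.
assert (Hl : l = (Z.of_nat m - Z.of_nat k)%Z) by (unfold k; lia).
assert (HlR : IZR l = INR m - INR k) by (rewrite Hl, minus_IZR, <- !INR_IZR_INZ; reflexivity).
(* For x <> 0 all terms in the braces are real, so the real identity turns the right-hand side into
   the prefactor of the Whittaker function times one series. *)
assert (Hrhs : forall x, x <> 0 -> exists s, is_pseries (kummer_dcoef k m) x s /\
  rhs x = (Cpower x (mu0 + / 2) * Cexp (- (x / 2))
       * RtoC (INR (k + m + 1) * Binomial.C (k + m) m * s))%C).
{ intros x Hx. destruct (kummer_bracket_pseries k m x) as [s [Hs E]].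
  exists s. split; [exact Hs|]. unfold rhs.
  rewrite <- RtoC_opp.
  rewrite (calP_RtoC (- l) k (k + m)), (calP_RtoC l m (k + m)) by lia.
  rewrite (calF_RtoC (- l) k m), (calF_RtoC l m k) by (lra || lia).
  rewrite Cexp_RtoC, <- !RtoC_pow.
  rewrite <- !RtoC_mult, <- !RtoC_minus, <- !RtoC_mult, <- RtoC_plus.
  replace (Z.to_nat (2 * Z.of_nat m + 1 - l)) with (k + m + 1)%nat by lia.
  replace (Z.to_nat (2 * Z.of_nat m - l)) with (k + m)%nat by lia.
  replace (2 * Z.of_nat m - l + 1)%Z with (Z.of_nat (k + m + 1)) by lia.
  rewrite <- INR_IZR_INZ, E, RtoC_mult.
  (* The exponents agree: l/2 - m + (k+m+1) = (k+m)/2 + 1 = mu0 + 1/2. *)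
  replace (mu0 + / 2)%C with (RtoC (IZR l / 2 - INR m) + INR (k + m + 1))%C.
  2:{ unfold mu0. rewrite <- RtoC_inv, <- !RtoC_plus by lra. f_equal.
      rewrite HlR, !plus_INR. simpl. field. }
  rewrite <- Cpower_mult_pow by exact Hx. rewrite !RtoC_mult. ring. }
split.
- intros x Hx. destruct (Hrhs x Hx) as [s [Hs ->]].
  apply is_derive_whittakerM; [| |exact Hs]; rewrite HlR, ?plus_INR; field.
(* The value is 0 because the power of x in the prefactor has exponent (k+m)/2 + 1 >= 1. *)
- exists (RtoC 0). split.
  (* All factors except the power of x; by continuity |g| <= |g(0)| + 1 near 0, so the right-hand
     side is O(|x|). *)
  + set (g := fun x => exp (- (x / 2)) * (INR (k + m + 1) * Binomial.C (k + m) m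
        * PSeries (kummer_dcoef k m) x)).
    apply filterlim_locally_C_0 with (Rabs (g 0) + 1).
    assert (Hg : continuity_pt g 0).
    { unfold g. repeat apply continuity_pt_mult; try (apply continuity_pt_const; now intros ? ?).
      - apply derivable_continuous_pt. reg.
      - apply PSeries_continuity. rewrite CV_radius_entire; [exact I|].
        intro x. destruct (kummer_bracket_pseries k m x) as [s [Hs _]]. now exists s. }
    destruct (proj1 (continuity_pt_locally g 0) Hg (mkposreal 1 Rlt_0_1)) as [d Hd].
    assert (Hd1 : 0 < Rmin d 1) by (apply Rmin_glb_lt; [apply cond_pos|lra]).
    exists (mkposreal _ Hd1). intros x Hx Hx0.
    change (Rabs (x - 0) < Rmin d 1) in Hx.
    pose proof (Rmin_l d 1). pose proof (Rmin_r d 1).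
    assert (Hgx : Rabs (g x - g 0) < 1).
    { apply (Hd x). change (Rabs (x - 0) < d). lra. }
    rewrite Rminus_0_r in Hx.
    destruct (Hrhs x Hx0) as [s [Hs ->]].
    rewrite <- Cmult_assoc, Cmod_mult.
    replace (mu0 + / 2)%C with (RtoC ((INR m + (1 - IZR l) / 2) + / 2)).
    2:{ unfold mu0. rewrite RtoC_plus, RtoC_inv by lra. reflexivity. }
    apply Rmult_le_compat; try apply Cmod_ge_0.
    * apply Cmod_Cpower_le; [exact Hx0|lra|].
      rewrite HlR. pose proof (pos_INR m). pose proof (pos_INR k). lra.
    * rewrite <- RtoC_div, <- RtoC_opp, Cexp_RtoC, <- RtoC_mult, Cmod_R by lra.
      rewrite <- (is_pseries_unique _ _ _ Hs). fold (g x).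
      replace (g x) with ((g x - g 0) + g 0) by ring.
      eapply Rle_trans; [apply Rabs_triang|]. lra.
  + apply is_derive_of_quadratic_bound with 0; [lra|]. intros h _.
    (* The exponent mu0 + 1/2 is nonzero, so [Cpower] at base 0 gives 0 and the function vanishes
       identically in kappa. *)
    assert (H0 : forall kappa, whittakerM kappa mu0 0 = RtoC 0).
    { intro kappa. unfold whittakerM, Cpower.
      destruct (Ceq_dec 0 0) as [_|H]; [|now elim H].
      destruct Ceq_dec as [E|_]; [|now rewrite !Cmult_0_l].
      exfalso. unfold mu0 in E. rewrite <- RtoC_inv, <- RtoC_plus in E by lra.
      apply RtoC_inj in E. rewrite HlR in E. pose proof (pos_INR m). pose proof (pos_INR k). lra. }
    rewrite !H0. replace (RtoC 0 - RtoC 0 - h * RtoC 0)%C with (RtoC 0) by ring.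
    rewrite Cmod_0. lra.
Qed.
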